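(* Let $R$ be a commutative Noetherian ring with unity, with total ring of fractions $Q(R)$. Let $M$ be a finitely generated $R$-submodule of $Q(R)$ containing a non-zero-divisor of $R$. Let $\Omega_R M$ be the first syzygy in some projective resolution of $M$. Then $$\operatorname{tr}_R(M)=\bigcap_{i>0,\ N\in \operatorname{mod} R} \operatorname{ann}_R \operatorname{Tor}^R_i(M,N)=\bigcap_{i>0,\ N\in \operatorname{Mod} R} \operatorname{ann}_R \operatorname{Ext}^i_R(M,N)=\operatorname{ann}_R\operatorname{Ext}^1_R(M,\Omega_R M).$$
   Context: $\operatorname{Mod} R$ denotes the category of all $R$-modules and $\operatorname{mod} R$ the category of all finitely generated $R$-modules. $Q(R)$ is the localization of $R$ at the set of all its non-zero-divisors, and $R$ is regarded as a subring of $Q(R)$; ''$M$ contains a non-zero-divisor of $R$'' means that some element of $M\cap R$ is a non-zero-divisor of $R$. The trace ideal of an $R$-module $M$ is $\operatorname{tr}_R(M)=\sum_{f\in \operatorname{Hom}_R(M,R)}\operatorname{Im}(f)$, an ideal of $R$. The first syzygy $\Omega_R M$ in a projective resolution of $M$ is the kernel of the augmentation: there is an exact sequence $0\to\Omega_R M\to P\to M\to 0$ with $P$ projective. For an $R$-module $X$, $\operatorname{ann}_R X=\{r\in R: rX=0\}$. *)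

(* Defs.v *)
From HB Require Import structures.
From mathcomp Require Import all_boot all_order all_algebra.
From mathcomp Require Import finmap generic_quotient ring.
From mathcomp Require Import mathcomp_extra boolp classical_sets functions.
From mathcomp Require Import cardinality.

Set Implicit Arguments.
Unset Strict Implicit.
Unset Printing Implicit Defensive.

Import GRing.Theory.
Local Open Scope classical_set_scope.
Local Open Scope ring_scope.
Local Open Scope quotient_scope.

(* Modules over R are arbitrary [lmodType R]; the choice structure packed in  *)
(* that interface exists on every type by the axioms of [boolp].  For the     *)
(* same reason a submodule may be given by a boolean predicate                *)
(* [S : submodClosed V].                                                      *)

Section Submodule.
Variables (R : pzRingType) (V : lmodType R) (S : submodClosed V).

Record submod := Submod { submod_val : V; _ : submod_val \in S }.

HB.instance Definition _ := [isSub for submod_val].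
HB.instance Definition _ := [Choice of submod by <:].
HB.instance Definition _ := [SubChoice_isSubLmodule of submod by <:].

End Submodule.

Section QuotientModule.
Variables (R : pzRingType) (V : lmodType R) (S : submodClosed V).

Lemma submod_opp (x : V) : x \in S -> - x \in S.
Proof. by move=> Sx; rewrite -scaleN1r rpredZ. Qed.

Definition quot_rel (x y : V) := x - y \in S.

Lemma quot_rel_equiv : equiv_class_of quot_rel.
Proof.
rewrite /quot_rel; split=> [x|x y|y x z Hxy Hyz].
- by rewrite subrr rpred0.
- by apply/idP/idP=> /submod_opp; rewrite opprB.
- by rewrite -(subrKA y) rpredD.
Qed.
Canonical quot_rel_canon := EquivRelPack quot_rel_equiv.

Definition quot_mod := {eq_quot quot_rel_canon}.
HB.instance Definition _ := Choice.on quot_mod.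
HB.instance Definition _ := EqQuotient.on quot_mod.

Definition quot_pi (x : V) : quot_mod := \pi x.

Lemma quot_piP (x y : V) : (quot_pi x = quot_pi y) <-> (x - y \in S).
Proof. by split=> [/eqmodP|h]; [|apply/eqmodP]. Qed.

Lemma quot_reprK (q : quot_mod) : quot_pi (repr q) = q.
Proof. exact: reprK. Qed.

Lemma quot_repr_pi (x : V) : repr (quot_pi x) - x \in S.
Proof. by apply/quot_piP; rewrite quot_reprK. Qed.

Definition quot_add (p q : quot_mod) := quot_pi (repr p + repr q).
Definition quot_opp (p : quot_mod) := quot_pi (- repr p).
Definition quot_scale (a : R) (p : quot_mod) := quot_pi (a *: repr p).

Lemma quot_addE x y : quot_add (quot_pi x) (quot_pi y) = quot_pi (x + y).
Proof. by apply/quot_piP; rewrite opprD addrACA rpredD ?quot_repr_pi. Qed.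
Lemma quot_oppE x : quot_opp (quot_pi x) = quot_pi (- x).
Proof. by apply/quot_piP; rewrite -opprD submod_opp ?quot_repr_pi. Qed.
Lemma quot_scaleE a x : quot_scale a (quot_pi x) = quot_pi (a *: x).
Proof. by apply/quot_piP; rewrite -scalerBr rpredZ ?quot_repr_pi. Qed.

Lemma quot_ind (P : quot_mod -> Prop) :
  (forall x, P (quot_pi x)) -> forall q, P q.
Proof. by move=> h q; rewrite -(quot_reprK q). Qed.

Lemma quot_addA : associative quot_add.
Proof.
by elim/quot_ind=> x; elim/quot_ind=> y; elim/quot_ind=> z; rewrite !quot_addE addrA.
Qed.
Lemma quot_addC : commutative quot_add.
Proof. by elim/quot_ind=> x; elim/quot_ind=> y; rewrite !quot_addE addrC. Qed.
Lemma quot_add0 : left_id (quot_pi 0) quot_add.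
Proof. by elim/quot_ind=> x; rewrite quot_addE add0r. Qed.
Lemma quot_addN : left_inverse (quot_pi 0) quot_opp quot_add.
Proof. by elim/quot_ind=> x; rewrite quot_oppE quot_addE addNr. Qed.

HB.instance Definition _ :=
  GRing.isZmodule.Build quot_mod quot_addA quot_addC quot_add0 quot_addN.

Lemma quot_scaleA a b p : quot_scale a (quot_scale b p) = quot_scale (a * b) p.
Proof. by elim/quot_ind: p => x; rewrite !quot_scaleE scalerA. Qed.
Lemma quot_scale1 : left_id 1 quot_scale.
Proof. by elim/quot_ind=> x; rewrite quot_scaleE scale1r. Qed.
Lemma quot_scaleDr : right_distributive quot_scale +%R.
Proof.
move=> a; elim/quot_ind=> x; elim/quot_ind=> y.
by rewrite [quot_pi x + _]quot_addE !quot_scaleE [RHS]quot_addE scalerDr.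
Qed.
Lemma quot_scaleDl p : {morph quot_scale^~ p : a b / a + b}.
Proof.
by elim/quot_ind: p => x a b; rewrite !quot_scaleE [RHS]quot_addE scalerDl.
Qed.

HB.instance Definition _ := GRing.Zmodule_isLmodule.Build R quot_mod
  quot_scaleA quot_scale1 quot_scaleDr quot_scaleDl.

Lemma quot_pi_linear : linear quot_pi.
Proof.
move=> a x y; transitivity (quot_add (quot_scale a (quot_pi x)) (quot_pi y)) => //.
by rewrite quot_scaleE quot_addE.
Qed.
HB.instance Definition _ := GRing.isLinear.Build R V quot_mod _ quot_pi quot_pi_linear.

Section Lift.
Variables (W : lmodType R) (f : {linear V -> W}).
Hypothesis fS : forall x, x \in S -> f x = 0.

Definition quot_lift of (forall x, x \in S -> f x = 0) :=
  fun q : quot_mod => f (repr q).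

Lemma quot_liftE x : quot_lift fS (quot_pi x) = f x.
Proof. apply/eqP; rewrite /quot_lift -subr_eq0 -raddfB; apply/eqP/fS/quot_repr_pi. Qed.

Lemma quot_lift_linear : linear (quot_lift fS).
Proof.
move=> a; elim/quot_ind=> x; elim/quot_ind=> y.
by rewrite -linearP !quot_liftE linearP.
Qed.
HB.instance Definition _ :=
  GRing.isLinear.Build R quot_mod W _ (quot_lift fS) quot_lift_linear.
End Lift.

End QuotientModule.

Section Kernel.
Variables (R : pzRingType) (B C : lmodType R) (g : {linear B -> C}).

Definition ker_pred : {pred B} := [pred b | g b == 0].

Lemma ker_pred_closed : submod_closed ker_pred.
Proof.
split=> [|a x y]; rewrite !inE; first by rewrite raddf0.
by move=> /eqP hx /eqP hy; rewrite linearP hx hy scaler0 addr0.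
Qed.
HB.instance Definition _ := GRing.isSubmodClosed.Build R B ker_pred ker_pred_closed.

Definition ker := submod ker_pred.
HB.instance Definition _ := GRing.SubLmodule.on ker.

Lemma ker_predP x : reflect (g x = 0) (x \in ker_pred).
Proof. exact: eqP. Qed.

End Kernel.
Arguments ker_pred {R B C} g _.
Arguments ker {R B C} g.

Section Generation.
Variables (R : pzRingType) (V : lmodType R).

Definition span (A : set V) : {pred V} :=
  fun v => `[< forall S : submodClosed V, A `<=` [set x | x \in S] -> v \in S >].

Lemma span_submod_closed A : submod_closed (span A).
Proof.
split=> [|a x y /asboolP hx /asboolP hy]; apply/asboolP=> S AS; first exact: rpred0.
by rewrite rpredD ?rpredZ ?hx ?hy.
Qed.
HB.instance Definition _ A :=
  GRing.isSubmodClosed.Build R V (span A) (span_submod_closed A).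

Definition finitely_generated (S : {pred V}) :=
  exists2 A : set V, finite_set A & S =i span A.

Definition ann : set R := [set r | forall v : V, r *: v = 0].

End Generation.
Arguments ann {R} V.

(* Ideals of a commutative ring R are the submodules of [R^o]. *)
Definition noetherian_ring (R : comPzRingType) :=
  forall I : submodClosed R^o, finitely_generated I.

Definition fg_module (R : pzRingType) (V : lmodType R) :=
  finitely_generated (predT : {pred V}).

Definition trace_ideal (R : comPzRingType) (V : lmodType R) : set R :=
  [set r | exists n (f : 'I_n -> {linear V -> R^o}) (x : 'I_n -> V),
             r = \sum_(k < n) f k (x k)].

Definition non_zero_divisor (R : comPzRingType) : {pred R} :=
  fun s => `[< forall x : R, s * x = 0 -> x = 0 >].
Arguments non_zero_divisor {R}.

Section TotalFractions.
Variable R : comPzRingType.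

Lemma nzd_cancel (s x y : R) : s \in non_zero_divisor -> s * x = s * y -> x = y.
Proof.
move=> /asboolP hs e; apply/eqP; rewrite -subr_eq0; apply/eqP/hs.
by rewrite mulrBr e subrr.
Qed.
Lemma nzd1 : 1 \in @non_zero_divisor R.
Proof. by apply/asboolP=> x; rewrite mul1r. Qed.
Lemma nzdM (s t : R) : s \in non_zero_divisor -> t \in non_zero_divisor ->
  s * t \in non_zero_divisor.
Proof. by move=> /asboolP hs /asboolP ht; apply/asboolP=> x; rewrite -mulrA => /hs/ht. Qed.

Record pre_frac := PreFrac { numer : R; denom : R; _ : denom \in non_zero_divisor }.

Lemma denomP (p : pre_frac) : denom p \in non_zero_divisor.
Proof. by case: p. Qed.

HB.instance Definition _ := gen_eqMixin pre_frac.
HB.instance Definition _ := gen_choiceMixin pre_frac.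

(* In the general localization, a/s = b/t means that u (a t - b s) = 0 for a  *)
(* denominator u; as u is here a non-zero-divisor, it can be dropped.         *)
Definition frac_rel (p q : pre_frac) := numer p * denom q == numer q * denom p.

Lemma frac_rel_equiv : equiv_class_of frac_rel.
Proof.
rewrite /frac_rel; split=> [x|x y|y x z /eqP Hxy /eqP Hyz] //.
apply/eqP; apply: (nzd_cancel (denomP y)).
transitivity ((numer x * denom y) * denom z); first by ring.
rewrite Hxy; transitivity ((numer y * denom z) * denom x); first by ring.
by rewrite Hyz; ring.
Qed.
Canonical frac_rel_canon := EquivRelPack frac_rel_equiv.

Definition total_frac := {eq_quot frac_rel_canon}.
HB.instance Definition _ := Choice.on total_frac.
HB.instance Definition _ := EqQuotient.on total_frac.

Definition frac (a s : R) (hs : s \in non_zero_divisor) : total_frac :=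
  \pi_total_frac (PreFrac a hs).

Lemma fracP a s hs b t ht : (@frac a s hs = @frac b t ht) <-> (a * t = b * s).
Proof. by split=> [/eqmodP/eqP|h]; [|apply/eqmodP/eqP]. Qed.

Lemma frac_ind (P : total_frac -> Prop) :
  (forall a s hs, P (@frac a s hs)) -> forall q, P q.
Proof. by move=> h q; rewrite -(reprK q); case: (repr q) => a s hs; exact: h. Qed.

Lemma frac_repr (q : total_frac) : frac (numer (repr q)) (denomP (repr q)) = q.
Proof. by rewrite -[RHS]reprK; case: (repr q) => a s hs; apply/fracP. Qed.

Definition frac_add (p q : total_frac) : total_frac :=
  let x := repr p in let y := repr q in
  frac (numer x * denom y + numer y * denom x) (nzdM (denomP x) (denomP y)).
Definition frac_opp (p : total_frac) : total_frac :=
  let x := repr p in frac (- numer x) (denomP x).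
Definition frac_mul (p q : total_frac) : total_frac :=
  let x := repr p in let y := repr q in
  frac (numer x * numer y) (nzdM (denomP x) (denomP y)).
Definition frac_scale (r : R) (p : total_frac) : total_frac :=
  let x := repr p in frac (r * numer x) (denomP x).

Lemma repr_frac a s hs :
  numer (repr (@frac a s hs)) * s = a * denom (repr (@frac a s hs)).
Proof. by have /fracP := frac_repr (frac a hs). Qed.

Lemma frac_addE a s hs b t ht :
  frac_add (@frac a s hs) (@frac b t ht) = frac (a * t + b * s) (nzdM hs ht).
Proof.
apply/fracP; have := repr_frac a hs; have := repr_frac b ht.
set x := repr _; set y := repr _ => e1 e2.
transitivity ((numer y * s) * (denom x * t) + (numer x * t) * (denom y * s)).
  by ring.
by rewrite e1 e2; ring.
Qed.
Lemma frac_oppE a s hs : frac_opp (@frac a s hs) = frac (- a) hs.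
Proof. by apply/fracP; rewrite !mulNr repr_frac. Qed.
Lemma frac_mulE a s hs b t ht :
  frac_mul (@frac a s hs) (@frac b t ht) = frac (a * b) (nzdM hs ht).
Proof.
apply/fracP; have := repr_frac a hs; have := repr_frac b ht.
set x := repr _; set y := repr _ => e1 e2.
transitivity ((numer y * s) * (numer x * t)); first by ring.
by rewrite e1 e2; ring.
Qed.
Lemma frac_scaleE r a s hs : frac_scale r (@frac a s hs) = frac (r * a) hs.
Proof. by apply/fracP; rewrite -!mulrA repr_frac. Qed.

Let fracE := (frac_addE, frac_oppE, frac_mulE, frac_scaleE).

Lemma frac_addA : associative frac_add.
Proof.
elim/frac_ind=> a s hs; elim/frac_ind=> b t ht; elim/frac_ind=> c u hu.
by rewrite !fracE; apply/fracP; ring.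
Qed.
Lemma frac_addC : commutative frac_add.
Proof.
by elim/frac_ind=> a s hs; elim/frac_ind=> b t ht; rewrite !fracE; apply/fracP; ring.
Qed.
Lemma frac_add0 : left_id (frac 0 nzd1) frac_add.
Proof. by elim/frac_ind=> a s hs; rewrite !fracE; apply/fracP; ring. Qed.
Lemma frac_addN : left_inverse (frac 0 nzd1) frac_opp frac_add.
Proof. by elim/frac_ind=> a s hs; rewrite !fracE; apply/fracP; ring. Qed.

HB.instance Definition _ :=
  GRing.isZmodule.Build total_frac frac_addA frac_addC frac_add0 frac_addN.

Lemma frac_mulA : associative frac_mul.
Proof.
elim/frac_ind=> a s hs; elim/frac_ind=> b t ht; elim/frac_ind=> c u hu.
by rewrite !fracE; apply/fracP; ring.
Qed.
Lemma frac_mulC : commutative frac_mul.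
Proof.
by elim/frac_ind=> a s hs; elim/frac_ind=> b t ht; rewrite !fracE; apply/fracP; ring.
Qed.
Lemma frac_mul1 : left_id (frac 1 nzd1) frac_mul.
Proof. by elim/frac_ind=> a s hs; rewrite !fracE; apply/fracP; ring. Qed.
Lemma frac_mulDl : left_distributive frac_mul +%R.
Proof.
elim/frac_ind=> a s hs; elim/frac_ind=> b t ht; elim/frac_ind=> c u hu.
by rewrite [frac a hs + _]frac_addE !fracE [RHS]frac_addE; apply/fracP; ring.
Qed.

HB.instance Definition _ := GRing.Zmodule_isComPzRing.Build total_frac
  frac_mulA frac_mulC frac_mul1 frac_mulDl.

Lemma frac_scaleA a b p : frac_scale a (frac_scale b p) = frac_scale (a * b) p.
Proof. by elim/frac_ind: p => c u hu; rewrite !fracE mulrA. Qed.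
Lemma frac_scale1 : left_id 1 frac_scale.
Proof. by elim/frac_ind=> c u hu; rewrite !fracE mul1r. Qed.
Lemma frac_scaleDr : right_distributive frac_scale +%R.
Proof.
move=> r; elim/frac_ind=> a s hs; elim/frac_ind=> b t ht.
by rewrite [frac a hs + _]frac_addE !fracE [RHS]frac_addE; apply/fracP; ring.
Qed.
Lemma frac_scaleDl p : {morph frac_scale^~ p : a b / a + b}.
Proof.
by elim/frac_ind: p => c u hu a b; rewrite !fracE [RHS]frac_addE; apply/fracP; ring.
Qed.

HB.instance Definition _ := GRing.Zmodule_isLmodule.Build R total_frac
  frac_scaleA frac_scale1 frac_scaleDr frac_scaleDl.

Definition to_frac (a : R) : total_frac := frac a nzd1.

Lemma to_frac_zmod_morphism : zmod_morphism to_frac.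
Proof.
move=> a b; transitivity (frac_add (to_frac a) (frac_opp (to_frac b))) => //.
by rewrite /to_frac !fracE; apply/fracP; ring.
Qed.
Lemma to_frac_monoid_morphism : monoid_morphism to_frac.
Proof.
split=> // a b; transitivity (frac_mul (to_frac a) (to_frac b)) => //.
by rewrite /to_frac !fracE; apply/fracP; ring.
Qed.
HB.instance Definition _ :=
  GRing.isZmodMorphism.Build R total_frac to_frac to_frac_zmod_morphism.
HB.instance Definition _ :=
  GRing.isMonoidMorphism.Build R total_frac to_frac to_frac_monoid_morphism.

Lemma to_frac_inj : injective to_frac.
Proof. by move=> a b /fracP; rewrite !mulr1. Qed.

Lemma frac_mul_denom a s hs : @frac a s hs * to_frac s = to_frac a.
Proof.
transitivity (frac_mul (frac a hs) (to_frac s)) => //.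
by rewrite /to_frac fracE; apply/fracP; ring.
Qed.

Lemma total_frac_scaleE r q : r *: q = to_frac r * q.
Proof.
elim/frac_ind: q => a s hs.
transitivity (frac_scale r (frac a hs)) => //.
transitivity (frac_mul (to_frac r) (frac a hs)) => //.
by rewrite /to_frac !fracE; apply/fracP; ring.
Qed.

End TotalFractions.

Section Hom.
Variables (R : comPzRingType) (A B : lmodType R).

Definition linear_pred : {pred A -> B} := fun f => `[< linear f >].

Lemma linear_pred_closed : submod_closed linear_pred.
Proof.
split=> [|a f g /asboolP hf /asboolP hg]; apply/asboolP.
  by move=> b x y; change (0 = b *: (0 : B) + 0); rewrite scaler0 addr0.
move=> b x y; rewrite !fctE hf hg !scalerDr !scalerA mulrC.
by rewrite addrACA.
Qed.
HB.instance Definition _ :=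
  GRing.isSubmodClosed.Build R (A -> B) linear_pred linear_pred_closed.

Definition Hom := submod linear_pred.
HB.instance Definition _ := GRing.Lmodule.on Hom.

End Hom.

Section HomMap.
Variables (R : comPzRingType) (A B N : lmodType R) (f : {linear A -> B}).

Lemma hom_map_subproof (h : Hom B N) : val h \o f \in @linear_pred R A N.
Proof.
by apply/asboolP=> a x y /=; case: h => /= h /asboolP hh; rewrite linearP hh.
Qed.
Definition hom_map (h : Hom B N) : Hom A N := Submod (hom_map_subproof h).

Lemma hom_map_linear : linear hom_map.
Proof. by move=> a g h; apply/val_inj. Qed.
HB.instance Definition _ :=
  GRing.isLinear.Build R (Hom B N) (Hom A N) _ hom_map hom_map_linear.

End HomMap.
Arguments hom_map {R A B} N f _.

(* The free module on [X] is the module of finitely supported functions.      *)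
Section Free.
Variables (R : pzRingType) (X : choiceType).

Definition fin_supp : {pred X -> R^o} :=
  fun f => `[< finite_set [set x | f x != 0] >].

Lemma fin_supp_closed : submod_closed fin_supp.
Proof.
split=> [|a f g /asboolP hf /asboolP hg]; apply/asboolP.
  by rewrite (_ : [set x | _] = set0) // -subset0 => x /=; rewrite eqxx.
have hfg : finite_set ([set x | f x != 0] `|` [set x | g x != 0]).
  by rewrite finite_setU.
apply: sub_finite_set hfg => x /=; rewrite !fctE.
have [->|] := eqVneq (f x) 0; last by left.
by rewrite scaler0 add0r; right.
Qed.
HB.instance Definition _ :=
  GRing.isSubmodClosed.Build R (X -> R^o) fin_supp fin_supp_closed.

Definition free := submod fin_supp.
HB.instance Definition _ := GRing.Lmodule.on free.

Lemma free_gen_subproof (x : X) : (fun y => (y == x)%:R) \in fin_supp.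
Proof.
apply/asboolP; apply: (@sub_finite_set _ _ [set x]); last exact: finite_set1.
by move=> y /=; have [-> //|_] := eqVneq y x; rewrite eqxx.
Qed.
Definition free_gen (x : X) : free := Submod (free_gen_subproof x).

Definition coef (f : free) (x : X) : R := val f x.

Lemma coef_linear a f h x : coef (a *: f + h) x = a * coef f x + coef h x.
Proof. by []. Qed.
Lemma coef_gen x y : coef (free_gen x) y = (y == x)%:R.
Proof. by []. Qed.
Lemma coef_sum (I : Type) (r : seq I) (F : I -> free) x :
  coef (\sum_(i <- r) F i) x = \sum_(i <- r) coef (F i) x.
Proof. exact: (big_morph (coef^~ x) (fun f h => erefl) erefl). Qed.
Lemma coefZ a f x : coef (a *: f) x = a * coef f x.
Proof. by []. Qed.

Definition free_supp (f : free) : {fset X} := fset_set [set x | coef f x != 0].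

Lemma mem_free_supp f x : (x \in free_supp f) = (coef f x != 0).
Proof.
have /asboolP hf := valP f; rewrite /free_supp in_fset_set //.
by apply/idP/idP => [/set_mem|/mem_set].
Qed.

Section Lift.
Variables (V : lmodType R) (g : X -> V).

Definition free_lift (f : free) : V := \sum_(x <- free_supp f) coef f x *: g x.

Lemma free_lift_wide (f : free) (D : {fset X}) :
  {subset free_supp f <= D} -> free_lift f = \sum_(x <- D) coef f x *: g x.
Proof.
move=> sD; apply: big_fset_incl; first exact/fsubsetP.
by move=> x _; rewrite mem_free_supp negbK => /eqP ->; rewrite scale0r.
Qed.

Lemma free_lift_linear : linear free_lift.
Proof.
move=> a f h.
rewrite (@free_lift_wide (a *: f + h) (free_supp f `|` free_supp h)%fset); last first.
  move=> x; rewrite in_fsetU !mem_free_supp coef_linear.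
  by have [->|//] := eqVneq (coef f x) 0; rewrite mulr0 add0r.
rewrite (@free_lift_wide f (free_supp f `|` free_supp h)%fset); last first.
  by move=> x; rewrite in_fsetU => ->.
rewrite (@free_lift_wide h (free_supp f `|` free_supp h)%fset); last first.
  by move=> x; rewrite in_fsetU => ->; rewrite orbT.
rewrite scaler_sumr -big_split /=; apply: eq_bigr => x _.
by rewrite coef_linear scalerDl scalerA.
Qed.
HB.instance Definition _ :=
  GRing.isLinear.Build R free V _ free_lift free_lift_linear.

Lemma free_lift_gen x : free_lift (free_gen x) = g x.
Proof.
rewrite (@free_lift_wide _ [fset x]%fset); last first.
  move=> y; rewrite mem_free_supp inE coef_gen.
  by have [//|_] := eqVneq y x; rewrite eqxx.
by rewrite big_seq_fset1 coef_gen eqxx scale1r.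
Qed.

End Lift.

Lemma free_expand (f : free) : f = \sum_(x <- free_supp f) coef f x *: free_gen x.
Proof.
apply/val_inj/funext => y; rewrite -[LHS]/(coef f y) -[RHS]/(coef _ y) coef_sum.
under eq_bigr do rewrite coefZ coef_gen.
have [hy|hy] := boolP (y \in free_supp f).
  rewrite (big_fsetD1 y) //= eqxx mulr1 big_seq big1 ?addr0 // => x.
  by rewrite in_fsetD1 eq_sym => /andP[/negPf ->]; rewrite mulr0.
rewrite big_seq big1 => [|x hx].
  by move: hy; rewrite mem_free_supp negbK => /eqP.
by have [e|_] := eqVneq y x; [rewrite e hx in hy|rewrite mulr0].
Qed.

End Free.

Section Tensor.
Variables (R : comPzRingType) (A N : lmodType R).

Let e (a : A) (n : N) := free_gen R (a, n).

Definition tensor_relators : set (free R (A * N)%type) :=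
  [set z | exists a b n, z = e (a + b) n - e a n - e b n] `|`
  [set z | exists a m n, z = e a (m + n) - e a m - e a n] `|`
  [set z | exists r a n, z = e (r *: a) n - r *: e a n] `|`
  [set z | exists r a n, z = e a (r *: n) - r *: e a n].

Definition tensor := quot_mod (span tensor_relators).
HB.instance Definition _ := GRing.Lmodule.on tensor.

Definition tens (a : A) (n : N) : tensor := quot_pi _ (e a n).

Lemma tensor_relatorP x y : tensor_relators (x - y) ->
  quot_pi (span tensor_relators) x = quot_pi (span tensor_relators) y.
Proof. by move=> h; apply/quot_piP/asboolP => S; apply. Qed.

Lemma tensDl a b n : tens (a + b) n = tens a n + tens b n.
Proof.
rewrite /tens -linearD; apply: tensor_relatorP.
by rewrite opprD addrA; do 3!left; exists a, b, n.
Qed.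
Lemma tensDr a m n : tens a (m + n) = tens a m + tens a n.
Proof.
rewrite /tens -linearD; apply: tensor_relatorP.
by rewrite opprD addrA; do 2!left; right; exists a, m, n.
Qed.
Lemma tensZl r a n : tens (r *: a) n = r *: tens a n.
Proof.
by rewrite /tens -linearZ; apply: tensor_relatorP; left; right; exists r, a, n.
Qed.
Lemma tensZr r a n : tens a (r *: n) = r *: tens a n.
Proof.
by rewrite /tens -linearZ; apply: tensor_relatorP; right; exists r, a, n.
Qed.

End Tensor.

Section TensorMap.
Variables (R : comPzRingType) (A B N : lmodType R) (f : {linear A -> B}).

Let pre_map : {linear free R (A * N)%type -> tensor B N} :=
  free_lift (fun p : A * N => tens (f p.1) p.2).

Lemma tensor_map_subproof z : z \in span (@tensor_relators R A N) -> pre_map z = 0.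
Proof.
move=> /asboolP h; apply/ker_predP; apply: h => {}z /= hz; apply/ker_predP.
case: hz => [[[|]|]|] [? [? [? ->]]]; rewrite raddfB ?raddfB /=.
- by rewrite !free_lift_gen /= linearD tensDl -addrA -opprD subrr.
- by rewrite !free_lift_gen /= tensDr -addrA -opprD subrr.
- by rewrite linearZ /= !free_lift_gen /= linearZ tensZl subrr.
- by rewrite linearZ /= !free_lift_gen /= tensZr subrr.
Qed.

Definition tensor_map : tensor A N -> tensor B N := quot_lift tensor_map_subproof.
HB.instance Definition _ := GRing.Linear.on tensor_map.

Lemma tensor_mapE a n : tensor_map (tens a n) = tens (f a) n.
Proof. by rewrite /tensor_map quot_liftE /= free_lift_gen. Qed.

End TensorMap.
Arguments tensor_map {R A B} N f _.

Section Homology.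
Variables (R : pzRingType) (A B C : lmodType R).
Variables (f : {linear A -> B}) (g : {linear B -> C}).

Definition im_pred : {pred ker g} := fun z => `[< exists a, f a = val z >].

Lemma im_pred_closed : submod_closed im_pred.
Proof.
split=> [|a x y /asboolP[u hu] /asboolP[v hv]]; apply/asboolP.
  by exists 0; rewrite !raddf0.
by exists (a *: u + v); rewrite !linearP hu hv.
Qed.
HB.instance Definition _ := GRing.isSubmodClosed.Build R (ker g) im_pred im_pred_closed.

(* This is [ker g / (im f :&: ker g)], which is the homology at [B] when      *)
(* [g \o f = 0]; that equation holds in all the uses below, and carrying it   *)
(* as an argument would not change the module.                                *)
Definition homology : lmodType R := quot_mod im_pred.

End Homology.
Arguments im_pred {R A B C} f g _.
Arguments homology {R A B C} f g.

Definition projective (R : pzRingType) (P : lmodType R) :=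
  forall (A B : lmodType R) (g : {linear A -> B}) (f : {linear P -> B}),
    (forall b, exists a, g a = b) -> exists h : {linear P -> A}, forall x, g (h x) = f x.

Record projective_resolution (R : pzRingType) (M : lmodType R) := ProjectiveResolution {
  res_mod : nat -> lmodType R;
  res_diff : forall n, {linear res_mod n.+1 -> res_mod n};
  res_aug : {linear res_mod 0 -> M};
  res_projective : forall n, projective (res_mod n);
  res_aug_surj : forall x, exists y, res_aug y = x;
  res_exact0 : forall x, res_aug x = 0 <-> exists y, res_diff 0 y = x;
  res_exactS : forall n x, res_diff n x = 0 <-> exists y, res_diff n.+1 y = x }.

Definition syzygy1 (R : pzRingType) (M : lmodType R) (F : projective_resolution M) :
  lmodType R := ker (res_aug F).

Section StandardResolution.
Variables (R : pzRingType).

Lemma free_projective (X : choiceType) : projective (free R X).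
Proof.
move=> A B g f gs.
have [h hE] := choice (fun x => gs (f (free_gen R x))).
exists (free_lift h) => z; rewrite [in RHS](free_expand z) /free_lift !raddf_sum /=.
by apply: eq_bigr => x _; rewrite !linearZ /= hE.
Qed.

Definition free_cover (V : lmodType R) : {linear free R V -> V} := free_lift id.

Fixpoint std_syz (M : lmodType R) n : lmodType R :=
  if n is m.+1 then ker (free_cover (std_syz M m)) else M.

Definition std_mod (M : lmodType R) n : lmodType R := free R (std_syz M n).

Definition std_diff (M : lmodType R) n : {linear std_mod M n.+1 -> std_mod M n} :=
  (val : ker (free_cover (std_syz M n)) -> _) \o free_cover (std_syz M n.+1).

Lemma free_cover_surj (V : lmodType R) (x : V) : exists y, free_cover V y = x.
Proof. by exists (free_gen R x); rewrite /= free_lift_gen. Qed.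

Lemma std_exact (M : lmodType R) n (x : std_mod M n) :
  free_cover (std_syz M n) x = 0 <-> exists y, std_diff M n y = x.
Proof.
split=> [/eqP hx|[y <-]]; last by apply/eqP; exact: (valP (free_cover (std_syz M n.+1) y)).
pose z : std_syz M n.+1 := Submod (hx : x \in ker_pred (free_cover (std_syz M n))).
by have [y hy] := free_cover_surj z; exists y; rewrite /std_diff /= [free_lift _ y]hy.
Qed.

Lemma std_exactS (M : lmodType R) n (x : std_mod M n.+1) :
  std_diff M n x = 0 <-> exists y, std_diff M n.+1 y = x.
Proof.
rewrite -std_exact; split=> [|h]; last by rewrite /std_diff /= [free_lift _ x]h.
by move=> h; apply: val_inj.
Qed.

(* The resolution by free modules on the underlying sets of the successive    *)
(* syzygies, which fixes a choice for [Tor] and [Ext]; another projective     *)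
(* resolution would give isomorphic modules.                                  *)
Definition std_resolution (M : lmodType R) : projective_resolution M :=
  @ProjectiveResolution R M (std_mod M) (std_diff M) (free_cover M)
    (fun n => @free_projective (std_syz M n)) (@free_cover_surj M)
    (@std_exact M 0) (@std_exactS M).

End StandardResolution.

Section TorExt.
Variable R : comPzRingType.

Definition Tor_res (M : lmodType R) (F : projective_resolution M) (i : nat)
    (N : lmodType R) : lmodType R :=
  match i with
  | 0 => homology (tensor_map N (res_diff F 0))
           (\0 : {linear tensor (res_mod F 0) N -> tensor (res_mod F 0) N})
  | j.+1 => homology (tensor_map N (res_diff F j.+1)) (tensor_map N (res_diff F j))
  end.

Definition Ext_res (M : lmodType R) (F : projective_resolution M) (i : nat)
    (N : lmodType R) : lmodType R :=
  match i with
  | 0 => homology (\0 : {linear Hom (res_mod F 0) N -> Hom (res_mod F 0) N})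
           (hom_map N (res_diff F 0))
  | j.+1 => homology (hom_map N (res_diff F j)) (hom_map N (res_diff F j.+1))
  end.

Definition Tor (i : nat) (M N : lmodType R) := Tor_res (std_resolution M) i N.
Definition Ext (i : nat) (M N : lmodType R) := Ext_res (std_resolution M) i N.

End TorExt.

(* Main.v *)
Require Import Defs.
From mathcomp Require Import all_boot all_order all_algebra.
From mathcomp Require Import mathcomp_extra boolp classical_sets functions.
From HB Require Import structures.
From mathcomp Require Import cardinality finmap.

Set Implicit Arguments.
Unset Strict Implicit.
Unset Printing Implicit Defensive.

Import GRing.Theory.
Local Open Scope classical_set_scope.
Local Open Scope ring_scope.

(** Call [r] stably null on [M] when multiplication by [r] on [M] factors
    through a projective module.  The theorem holds because, for a fractional
    module [M] that contains a non-zero-divisor, all four sets consist of the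
    [r] that are stably null.

    For the trace ideal, every linear form on a submodule of the total ring of
    fractions is multiplication by a fraction, so that [f x *: y = f y *: x]
    (functional_exchange).  Hence the multiplication by [f x] is the composite
    of [f : M -> R] and of [a |-> a *: x], and the trace consists of stably
    null elements (trace_factor).  Conversely a factorization through a
    projective, hence through a free module, writes [r *: m] as the sum of the
    [f_i m *: x_i]; for [m] a non-zero-divisor [a] the exchange rule turns
    [r *: a] into [(\sum_i f_i x_i) *: a], and cancelling [a] leaves [r] in the
    trace (factor_trace).

    A stably null [r] acts on a projective resolution by a chain map that is
    null-homotopic in positive degrees (factor_nullhomotopic), and null
    homotopies survive any [R]-linear functor; so [r] kills all Tor and Ext
    modules of positive degree.

    Conversely, the extension of [M] by its first syzygy given by a projective
    module onto [M] is the universal one: if [r] kills its class, then multiplication by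
    [r] lifts along the augmentation (ann_Ext_factor).  For Tor, the universal
    coefficient module is the Auslander transpose [Tr M]: the module
    [Tor 1 M (Tr M)] is that of the endomorphisms of [M] modulo those that
    factor through a projective, and [r] annihilates the class of the identity
    exactly when [r] is stably null.  The implication from Tor to stable
    nullity is read off from a presentation matrix (ann_Tor_factor); the
    Noetherian hypothesis makes [M] finitely presented, so that [Tr M] exists
    and is finitely generated. *)

(** * Linear maps *)

Section LinearMaps.
Variable R : pzRingType.
Implicit Types A B C P : lmodType R.

Definition mk_linear A B (f : A -> B) (fL : linear f) : {linear A -> B} :=
  let fM := GRing.isLinear.Build R A B _ f fL in HB.pack f fM.

Lemma to_ker_subproof A B C (e : {linear B -> C}) (u : {linear A -> B})
    (eu : forall a, e (u a) = 0) a : u a \in ker_pred e.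
Proof. exact/ker_predP. Qed.

Definition to_ker_fun A B C (e : {linear B -> C}) (u : {linear A -> B})
    (eu : forall a, e (u a) = 0) (a : A) : ker e :=
  Submod (to_ker_subproof eu a).

Lemma to_ker_linear A B C (e : {linear B -> C}) (u : {linear A -> B})
    (eu : forall a, e (u a) = 0) : linear (to_ker_fun eu).
Proof. by move=> a x y; apply: val_inj; rewrite /= linearP. Qed.

Definition to_ker A B C (e : {linear B -> C}) (u : {linear A -> B})
    (eu : forall a, e (u a) = 0) : {linear A -> ker e} :=
  mk_linear (to_ker_linear eu).

Lemma surj_factor A B C (g : {linear A -> B}) (f : {linear A -> C}) :
  (forall b, exists a, g a = b) -> (forall a, g a = 0 -> f a = 0) ->
  exists h : {linear B -> C}, forall a, h (g a) = f a.
Proof.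
move=> /choice[s sK] gf.
have fE a a' : g a = g a' -> f a = f a'.
  move=> e; apply/eqP; rewrite -subr_eq0 -raddfB; apply/eqP/gf.
  by rewrite linearB e subrr.
have hL : linear (f \o s).
  by move=> a x y /=; rewrite -linearP; apply: fE; rewrite linearP !sK.
by exists (mk_linear hL) => a /=; apply: fE; rewrite sK.
Qed.

(** A projective module lifts along surjections only; exactness at [B] says
    that [d] is one onto the kernel of [e], where [u] takes its values. *)
Lemma projective_lift P A B C (d : {linear A -> B}) (e : {linear B -> C})
    (u : {linear P -> B}) :
  projective P -> (forall x, e x = 0 <-> exists y, d y = x) ->
  (forall p, e (u p) = 0) -> exists h : {linear P -> A}, forall p, d (h p) = u p.
Proof.
move=> projP exd eu.
have ed a : e (d a) = 0 by apply/exd; exists a.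
have [|h hE] := projP _ _ (to_ker ed) (to_ker eu).
  move=> b; have /exd[a da] : e (val b) = 0 by exact/ker_predP/(valP b).
  by exists a; apply: val_inj.
by exists h => p; have /(congr1 val) := hE p.
Qed.

Lemma ann_homologyP A B C (f : {linear A -> B}) (g : {linear B -> C}) r :
  ann (homology f g) r <-> forall y, g y = 0 -> exists x, f x = r *: y.
Proof.
split=> [h y /eqP gy|h].
  pose z : ker g := Submod (gy : y \in ker_pred g).
  have := h (quot_pi _ z); rewrite -linearZ -(raddf0 (@quot_pi _ _ (im_pred f g))).
  by move=> /quot_piP; rewrite subr0 => /asboolP.
move=> q; rewrite -[q]quot_reprK; move: (repr q) => z.
have [x fx] := h (val z) (elimT (ker_predP _ _) (valP z)).
rewrite -linearZ -(raddf0 (@quot_pi _ _ (im_pred f g))).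
by apply/quot_piP; rewrite subr0; apply/asboolP; exists x.
Qed.

End LinearMaps.

(** * Maps out of tensor products *)

Section TensorMaps.
Variable R : comPzRingType.

Lemma tens_linearr (A N : lmodType R) (a : A) : linear (@tens R A N a).
Proof. by move=> c x y; rewrite tensDr tensZr. Qed.

Lemma tens_linearl (A N : lmodType R) (n : N) : linear ((@tens R A N)^~ n).
Proof. by move=> c x y; rewrite tensDl tensZl. Qed.

Lemma tens0r (A N : lmodType R) (a : A) : tens a (0 : N) = 0.
Proof. exact: (linear0 (mk_linear (@tens_linearr A N a))). Qed.

Lemma tens_suml (A N : lmodType R) n (c : 'I_n -> R) (a : 'I_n -> A) (x : N) :
  tens (\sum_i c i *: a i) x = \sum_i c i *: tens (a i) x.
Proof.
rewrite [LHS](linear_sum (mk_linear (@tens_linearl A N x))).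
by apply: eq_bigr => i _; rewrite linearZ.
Qed.

Lemma tens_sumr (A N : lmodType R) n (c : 'I_n -> R) (a : A) (x : 'I_n -> N) :
  tens a (\sum_i c i *: x i) = \sum_i c i *: tens a (x i).
Proof.
rewrite [LHS](linear_sum (mk_linear (@tens_linearr A N a))).
by apply: eq_bigr => i _; rewrite linearZ.
Qed.

Lemma tensor_ext (A N W : lmodType R) (f g : {linear tensor A N -> W}) :
  (forall a n, f (tens a n) = g (tens a n)) -> f =1 g.
Proof.
move=> fg; elim/quot_ind=> x; rewrite (free_expand x) !linear_sum.
by apply: eq_bigr => -[a n] _; rewrite !linearZ; congr (_ *: _); exact: fg.
Qed.

Lemma tensor_lift (A N W : lmodType R) (b : A -> N -> W) :
  (forall a, linear (b a)) -> (forall n, linear (b^~ n)) ->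
  exists f : {linear tensor A N -> W}, forall a n, f (tens a n) = b a n.
Proof.
move=> bL bR.
have [g gE] : exists g : {linear Defs.free R (A * N)%type -> W},
    forall a n, g (free_gen R (a, n)) = b a n.
  by exists (free_lift (fun p : A * N => b p.1 p.2)) => a n /=; rewrite free_lift_gen.
have bl0 n : b 0 n = 0 by exact: (raddf0 (mk_linear (bR n))).
have br0 a : b a 0 = 0 by exact: (raddf0 (mk_linear (bL a))).
have g0 z : z \in Defs.span (@tensor_relators R A N) -> g z = 0.
  move=> /asboolP h; apply/ker_predP; apply: h => {}z /= hz; apply/ker_predP.
  case: hz => [[[|]|]|] [x [y [t ->]]]; rewrite linearB.
  - have := bR t 1 x y; rewrite linearB !gE /= !scale1r => ->.
    by rewrite -addrA -opprD subrr.
  - have := bL x 1 y t; rewrite linearB !gE /= !scale1r => ->.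
    by rewrite -addrA -opprD subrr.
  - by have := bR t x y 0; rewrite linearZ !gE /= !addr0 bl0 addr0 => ->; rewrite subrr.
  - by have := bL y x t 0; rewrite linearZ !gE /= !addr0 br0 addr0 => ->; rewrite subrr.
by exists (quot_lift g0) => a n; rewrite -gE; exact: quot_liftE.
Qed.

End TensorMaps.

(** * Null-homotopic multiplications *)

Section Homotopy.
Variables (R : comPzRingType) (M : lmodType R) (F : projective_resolution M).
Variable r : R.

Lemma res_dd n x : res_diff F n (res_diff F n.+1 x) = 0.
Proof. by apply/res_exactS; exists x. Qed.

Lemma res_augd x : res_aug F (res_diff F 0 x) = 0.
Proof. by apply/res_exact0; exists x. Qed.

(** The factorization [s] is the bottom step of a contracting homotopy for
    multiplication by [r].  At each degree the defect [r *: x - h (d x)] is a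
    cycle, because the homotopy identity holds one degree below; exactness and
    projectivity lift it to the next component of the homotopy. *)
Lemma factor_nullhomotopic (s : {linear M -> res_mod F 0}) :
  (forall m, res_aug F (s m) = r *: m) -> forall n,
  exists (h : {linear res_mod F n -> res_mod F n.+1})
         (h' : {linear res_mod F n.+1 -> res_mod F n.+2}),
    forall x, res_diff F n.+1 (h' x) + h (res_diff F n x) = r *: x.
Proof.
move=> sE.
have next n (h : {linear res_mod F n -> res_mod F n.+1}) :
    (forall x, res_diff F n (h (res_diff F n x)) = r *: res_diff F n x) ->
    exists h' : {linear res_mod F n.+1 -> res_mod F n.+2},
      forall x, res_diff F n.+1 (h' x) + h (res_diff F n x) = r *: x.
  move=> hE.
  pose u : {linear res_mod F n.+1 -> res_mod F n.+1} :=
    (r \*: idfun) \- (h \o res_diff F n).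
  have [|h' h'E] := @projective_lift _ _ _ _ _ _ _ u
     (@res_projective _ _ F n.+1) (@res_exactS _ _ F n).
    by move=> x /=; rewrite linearB linearZ /= hE subrr.
  by exists h' => x; rewrite h'E /= subrK.
elim=> [|n [h [h' hE]]].
  pose u : {linear res_mod F 0 -> res_mod F 0} :=
    (r \*: idfun) \- (s \o res_aug F).
  have [|h hE] := @projective_lift _ _ _ _ _ _ _ u
     (@res_projective _ _ F 0) (@res_exact0 _ _ F).
    by move=> x /=; rewrite linearB linearZ /= sE subrr.
  have [|h' h'E] := next 0 h; last by exists h, h'.
  by move=> x; rewrite hE /= res_augd raddf0 subr0.
have [|h'' h''E] := next n.+1 h'; last by exists h', h''.
by move=> x; rewrite -(hE (res_diff F n.+1 x)) res_dd raddf0 addr0.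
Qed.

Lemma nullhomotopic_ann_Tor n (N : lmodType R)
    (h : {linear res_mod F n -> res_mod F n.+1})
    (h' : {linear res_mod F n.+1 -> res_mod F n.+2}) :
  (forall x, res_diff F n.+1 (h' x) + h (res_diff F n x) = r *: x) ->
  ann (Tor_res F n.+1 N) r.
Proof.
move=> hE; apply/ann_homologyP => z dz.
exists (tensor_map N h' z).
pose T : {linear tensor (res_mod F n.+1) N -> tensor (res_mod F n.+1) N} :=
  (tensor_map N (res_diff F n.+1) \o tensor_map N h') \+
  (tensor_map N h \o tensor_map N (res_diff F n)).
have TE : T =1 (r \*: idfun).
  by apply: tensor_ext => a m /=; rewrite !tensor_mapE -tensDl hE tensZl.
by have := TE z; rewrite /= dz raddf0 addr0.
Qed.

Lemma nullhomotopic_ann_Ext n (N : lmodType R)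
    (h : {linear res_mod F n -> res_mod F n.+1})
    (h' : {linear res_mod F n.+1 -> res_mod F n.+2}) :
  (forall x, res_diff F n.+1 (h' x) + h (res_diff F n x) = r *: x) ->
  ann (Ext_res F n.+1 N) r.
Proof.
move=> hE; apply/ann_homologyP => u du.
exists (hom_map N h u); apply/val_inj/funext => x /=.
have uL : linear (val u) by apply/asboolP/(valP u).
transitivity (val u (r *: x)); last exact: (linearZ_LR (mk_linear uL) r x).
rewrite -hE [RHS](raddfD (mk_linear uL)) /=.
by have /(congr1 val)/(congr1 (@^~ (h' x)))/= -> := du; rewrite [X in X + _](_ : _ = 0) ?add0r.
Qed.

End Homotopy.

(** Comparing the resolutions gives [u : G_0 -> F_0] over the identity of [M],
    and [u \o d] is a cocycle with values in the syzygy.  If [r] times it is the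
    coboundary of [w], then [r *: u - w] vanishes on the boundaries, hence
    descends to a map [M -> F_0]; the augmentation kills [w], so that this map
    lifts multiplication by [r]. *)
Lemma ann_Ext_factor (R : comPzRingType) (M : lmodType R)
    (F G : projective_resolution M) r :
  ann (Ext_res G 1 (syzygy1 F)) r ->
  exists s : {linear M -> res_mod F 0}, forall m, res_aug F (s m) = r *: m.
Proof.
move=> /ann_homologyP annr.
have [u uE] := @res_projective _ _ G 0 _ _ _ (res_aug G) (@res_aug_surj _ _ F).
have cE p : res_aug F ((u \o res_diff G 0) p) = 0 by rewrite /= uE res_augd.
pose c := to_ker cE.
have cL : (c : _ -> _) \in @linear_pred R (res_mod G 1) (syzygy1 F).
  by apply/asboolP; exact: linearP.
have [|w wE] := annr (Submod cL).
  apply/val_inj/funext => x; apply: val_inj => /=.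
  by rewrite res_dd raddf0.
(* The cochain [w] is a plain function; restore its linear structure. *)
have wL : linear (val w) by apply/asboolP/(valP w).
pose t : {linear res_mod G 0 -> res_mod F 0} :=
  (r \*: u) \- (val \o mk_linear wL).
have [||s sE] := @surj_factor _ _ _ _ (res_aug G) t.
- exact: res_aug_surj.
- move=> _ /res_exact0[y <-] /=; apply/eqP; rewrite subr_eq0; apply/eqP.
  by have /(congr1 val)/(congr1 (fun f => val (f y)))/= -> := wE.
exists s => m; have [y <-] := res_aug_surj G m.
rewrite sE /= linearB linearZ /= uE.
by rewrite [X in _ - X](elimT (ker_predP _ _) (valP (val w y))) subr0.
Qed.

(** * Finite generation *)

Section FiniteGeneration.

Definition mk_submod (R : pzRingType) (V : lmodType R) (P : {pred V})
    (PS : submod_closed P) : submodClosed V :=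
  let PM := GRing.isSubmodClosed.Build R V P PS in HB.pack P PM.

Lemma sum_delta_scale (R : pzRingType) (V : lmodType R) n (x : 'I_n -> V) i :
  \sum_j (delta_mx 0 i : 'rV[R]_n) 0 j *: x j = x i.
Proof.
rewrite (bigD1 i) //= big1 ?addr0 => [|j ji]; first by rewrite mxE !eqxx scale1r.
by rewrite mxE (negPf ji) andbF scale0r.
Qed.

Lemma fg_family (R : pzRingType) (V : lmodType R) (S : {pred V}) :
  finitely_generated S -> exists n (x : 'I_n -> V),
    forall v, v \in S <-> exists c : 'rV[R]_n, v = \sum_i c 0 i *: x i.
Proof.
move=> [_ /finite_seqP[s ->] SE].
exists (size s), (tnth (in_tuple s)) => v; rewrite SE; split; last first.
  move=> [c ->]; apply: rpred_sum => i _; apply/rpredZ/asboolP => T; apply.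
  exact: mem_tnth.
pose P : {pred V} := fun v => `[< exists c : 'rV[R]_(size s),
  v = \sum_i c 0 i *: tnth (in_tuple s) i >].
have PS : submod_closed P.
  split=> [|a x y /asboolP[c ->] /asboolP[d ->]]; apply/asboolP.
    by exists 0; rewrite big1 // => i _; rewrite mxE scale0r.
  exists (a *: c + d); rewrite scaler_sumr -big_split /=.
  by apply: eq_bigr => i _; rewrite !mxE scalerDl scalerA.
move=> /asboolP/(_ (mk_submod PS)) vS.
suff /asboolP : v \in P by [].
apply: vS => x /= xs.
apply/asboolP; have /tnthP[i ->] : x \in in_tuple s by [].
by exists (delta_mx 0 i); rewrite sum_delta_scale.
Qed.

Lemma family_fg (R : pzRingType) (V : lmodType R) n (x : 'I_n -> V) :
  (forall v, exists c : 'rV[R]_n, v = \sum_i c 0 i *: x i) -> fg_module V.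
Proof.
move=> xV; exists [set` codom x]; first exact/finite_seqP/(ex_intro _ (codom x)).
move=> v; have [c ->] := xV v; symmetry; apply: rpred_sum => i _.
by apply/rpredZ/asboolP => T; apply; exact: codom_f.
Qed.

Lemma fg_submod (R : pzRingType) (V : lmodType R) (S : submodClosed V) :
  finitely_generated S -> fg_module (submod S).
Proof.
move=> /fg_family[n [x xS]].
have xP i : x i \in S.
  by apply/xS; exists (delta_mx 0 i); rewrite sum_delta_scale.
apply: (@family_fg _ _ n (fun i => Submod (xP i))) => v.
have /xS[c cE] := valP v; exists c; apply: val_inj.
by rewrite [LHS]cE [RHS]raddf_sum.
Qed.

(** Induction on the length: the first entries of the rows in [P] form an
    ideal, generated by the first entries of finitely many rows of [P];
    subtracting a combination of those rows leaves a row of [P] that starts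
    with 0, to which the induction hypothesis applies. *)
Lemma noetherian_row (R : comPzRingType) : noetherian_ring R ->
  forall n (P : submodClosed 'rV[R]_n), exists m (A : 'M[R]_(m, n)),
    forall v, v \in P <-> exists b, v = b *m A.
Proof.
move=> nR; elim=> [P|n IH].
  exists 0%N, 0 => v; rewrite (thinmx0 v) rpred0; split=> // _.
  by exists 0; rewrite mulmx0.
(* Block operations on rows require the dimension to be a visible sum. *)
rewrite -[n.+1]/(1 + n)%N => P.
pose I : {pred R^o} := fun a => `[< exists w : 'rV[R]_n, row_mx a%:M w \in P >].
have IS : submod_closed I.
  split=> [|a x y /asboolP[v vP] /asboolP[w wP]]; apply/asboolP.
    by exists 0; rewrite raddf0 row_mx0 rpred0.
  exists (a *: v + w).
  by rewrite raddfD /= -scale_scalar_mx -add_row_mx -scale_row_mx rpredD ?rpredZ.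
pose Q : {pred 'rV[R]_n} := fun w => (row_mx (0 : 'rV_1) w) \in P.
have QE w : (w \in Q) = (row_mx (0 : 'rV_1) w \in P) by [].
have QS : submod_closed Q.
  split=> [|a v w]; rewrite !QE; first by rewrite row_mx0 rpred0.
  move=> vQ wQ.
  have -> : row_mx (0 : 'rV_1) (a *: v + w) = a *: row_mx 0 v + row_mx 0 w.
    by rewrite scale_row_mx add_row_mx scaler0 add0r.
  by rewrite rpredD ?rpredZ.
have [k [x xI]] := fg_family (nR (mk_submod IS)).
have [m [A AQ]] := IH (mk_submod QS).
have /choice[w wP] : forall i, exists w : 'rV[R]_n, row_mx (x i)%:M w \in P.
  move=> i; apply/asboolP; apply/xI; exists (delta_mx 0 i).
  by rewrite sum_delta_scale.
pose X : 'cV[R]_k := \col_i x i.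
pose B := row_mx X (\matrix_i w i).
have BP (b : 'rV_k) : b *m B \in P.
  rewrite mulmx_sum_row; apply: rpred_sum => i _; rewrite rpredZ // row_row_mx rowK.
  by rewrite (_ : row i X = (x i)%:M) //; apply/rowP => j; rewrite !mxE (ord1 j).
exists (k + m)%N, (col_mx B (row_mx 0 A)) => v; split; last first.
  move=> [b ->]; rewrite -[b]hsubmxK mul_row_col rpredD // mul_mx_row mulmx0.
  by rewrite -QE; apply/(AQ _); exists (rsubmx b).
rewrite -[v]hsubmxK => vP.
have /xI[c cE] : (lsubmx v) 0 0 \in mk_submod IS.
  by apply/asboolP; exists (rsubmx v); rewrite -mx11_scalar.
have cX : c *m X = lsubmx v.
  apply/rowP => j; rewrite (ord1 j) cE mxE; apply: eq_bigr => i _.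
  by rewrite mxE.
have /AQ[b bE] : rsubmx v - c *m (\matrix_i w i) \in mk_submod QS.
  rewrite [_ \in _]QE -(subrr (lsubmx v)) -{2}cX.
  rewrite -add_row_mx -opp_row_mx -mul_mx_row rpredD //.
  by rewrite -scaleN1r rpredZ.
exists (row_mx c b); rewrite mul_row_col mul_mx_row cX mul_mx_row mulmx0 -bE.
by rewrite add_row_mx addr0 addrC subrK.
Qed.

End FiniteGeneration.

(** * The Auslander transpose and Tor *)

Section Transpose.
Variable R : comPzRingType.

Lemma transpose_rel_closed m n (A : 'M[R]_(m, n)) :
  submod_closed (fun v : 'rV[R]_m => `[< exists c : 'rV[R]_n, v = c *m A^T >]).
Proof.
split=> [|a x y /asboolP[c ->] /asboolP[d ->]]; apply/asboolP.
  by exists 0; rewrite mul0mx.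
by exists (a *: c + d); rewrite mulmxDl scalemxAl.
Qed.

(** The rows of [A] are seen as [m] relations among [n] generators.  The
    transpose exchanges the two roles: a generator for each relation and a
    relation for each generator.  When [A] presents [M], this is the Auslander
    transpose of [M]. *)
Definition transpose_module m n (A : 'M[R]_(m, n)) : lmodType R :=
  quot_mod (mk_submod (transpose_rel_closed A)).

Definition transpose_gen m n (A : 'M[R]_(m, n)) (j : 'I_m) : transpose_module A :=
  quot_pi _ (delta_mx 0 j : 'rV_m).

Lemma transpose_piE m n (A : 'M[R]_(m, n)) (v : 'rV_m) :
  quot_pi _ v = \sum_j v 0 j *: transpose_gen A j.
Proof.
rewrite {1}(row_sum_delta v) linear_sum.
by apply: eq_bigr => j _; rewrite linearZ.
Qed.

Lemma transpose_rel m n (A : 'M[R]_(m, n)) i :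
  \sum_j A j i *: transpose_gen A j = 0.
Proof.
transitivity (quot_pi (mk_submod (transpose_rel_closed A)) (row i A^T)).
  by rewrite transpose_piE; apply: eq_bigr => j _; rewrite !mxE.
rewrite -(linear0 (@quot_pi _ _ _)); apply/quot_piP; rewrite subr0.
by apply/asboolP; exists (delta_mx 0 i); rewrite -rowE.
Qed.

Lemma transpose_fg m n (A : 'M[R]_(m, n)) : fg_module (transpose_module A).
Proof.
apply: (@family_fg _ _ m (transpose_gen A)); elim/quot_ind => v.
by exists v; exact: transpose_piE.
Qed.

Lemma combination_closed (V : lmodType R) (S : submodClosed V) m n (A : 'M[R]_(m, n)) :
  submod_closed (fun w : 'I_m -> V => `[< exists2 h : 'I_n -> V,
    forall i, h i \in S & forall j, w j = \sum_i A j i *: h i >]).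
Proof.
split=> [|a x y /asboolP[h hS hE] /asboolP[k kS kE]]; apply/asboolP.
  exists (fun=> 0) => [i|j]; first exact: rpred0.
  by rewrite big1 // => i _; rewrite scaler0.
exists (fun i => a *: h i + k i) => [i|j]; first by rewrite rpredD ?rpredZ.
rewrite !fctE hE kE scaler_sumr -big_split /=.
by apply: eq_bigr => i _; rewrite scalerDr !scalerA mulrC.
Qed.

(** As [transpose_module A] is the cokernel of the transpose of [A], tensoring
    [K] with it yields the cokernel of [A : K^n -> K^m].  So the map
    [g (x) v |-> (v_j *: d g)_j] is well defined from [K (x) transpose_module A]
    to [V^m / A S^n], and it kills the image of [e].  Evaluating it on both
    sides of the hypothesis on [w] shows that the family of the
    [r *: d (g j)] lies in [A S^n]. *)
Lemma transpose_tensor_boundary (K V : lmodType R) (d : {linear K -> V})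
    (S : submodClosed V) (r : R) m n (A : 'M[R]_(m, n)) (g : 'I_m -> K)
    (B : lmodType R) (e : {linear B -> K}) (w : tensor B (transpose_module A)) :
  (forall k, d k \in S) -> (forall b, d (e b) = 0) ->
  tensor_map _ e w = \sum_j tens (r *: g j) (transpose_gen A j) ->
  exists2 h : 'I_n -> V, forall i, h i \in S &
    forall j, r *: d (g j) = \sum_i A j i *: h i.
Proof.
move=> dS de wE.
pose Q := quot_mod (mk_submod (@combination_closed V S m n A)).
pose q : {linear ('I_m -> V) -> Q} := quot_pi _.
have qP x : q x = 0 -> exists2 h : 'I_n -> V, forall i, h i \in S &
    forall j, x j = \sum_i A j i *: h i.
  by rewrite -(linear0 q) => /quot_piP; rewrite subr0 => /asboolP.
have qP' x : (exists2 h : 'I_n -> V, forall i, h i \in S &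
    forall j, x j = \sum_i A j i *: h i) -> q x = 0.
  by move=> h; rewrite -(linear0 q); apply/quot_piP; rewrite subr0; apply/asboolP.
have psiL k : linear (fun (v : 'rV[R]_m) (j : 'I_m) => v 0 j *: d k).
  by move=> a x y; apply/funext => j; rewrite !fctE !mxE scalerDl scalerA.
have /choice[b bE] : forall k, exists f : {linear transpose_module A -> Q},
    forall v, f (quot_pi _ v) = q (fun j => v 0 j *: d k).
  move=> k; apply: (@surj_factor _ _ _ _ _ (q \o mk_linear (psiL k))).
    by elim/quot_ind=> v; exists v.
  move=> v; rewrite -(linear0 (@quot_pi _ _ _)) => /quot_piP; rewrite subr0.
  move=> /asboolP[c ->]; apply: qP'; exists (fun i => c 0 i *: d k) => [i|j].
    by rewrite rpredZ.
  rewrite /= mxE scaler_suml; apply: eq_bigr => i _.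
  by rewrite mxE scalerA mulrC.
have [||f fE] := @tensor_lift _ K (transpose_module A) Q (fun k => b k).
- by move=> k; exact: linearP.
- elim/quot_ind=> v a x y /=; rewrite !bE -linearP; congr (q _).
  apply/funext => j; rewrite !fctE linearP scalerDr !scalerA.
  by rewrite mulrC.
apply: (@qP (fun j => r *: d (g j))).
have f0 : f (tensor_map _ e w) = 0.
  have E : f \o tensor_map _ e =1 \0.
    apply: tensor_ext => a; elim/quot_ind=> v /=.
    rewrite tensor_mapE fE bE -[RHS](linear0 q); congr (q _).
    by apply/funext => j; rewrite de scaler0.
  exact: (E w).
rewrite -f0 wE linear_sum /=.
under eq_bigr do rewrite fE bE.
rewrite -linear_sum; congr (q _).
apply/funext => j; rewrite fct_sumE (bigD1 j) //= big1 ?addr0 => [|i ij].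
  by rewrite mxE !eqxx scale1r linearZ.
by rewrite mxE eq_sym (negPf ij) andbF scale0r.
Qed.

(** Lift the generators [x i] of [M] to [y i] in [F_0] and the relations
    [A j i] to [g j] in [F_1], so that [d (g j) = \sum_i A j i *: y i].  The
    tensor [\sum_j g j (x) e_j] over the transpose of [A] is a cycle, by the very
    relations of the transpose.  If [r] times it bounds, the previous lemma gives
    corrections [h i] in the syzygy with
    [\sum_i A j i *: (r *: y i - h i) = 0]; thus [x i |-> r *: y i - h i] respects
    all relations and defines the required map on [M]. *)
Lemma ann_Tor_factor (M : lmodType R) (F : projective_resolution M) (r : R) :
  noetherian_ring R -> fg_module M ->
  (forall N, fg_module N -> ann (Tor_res F 1 N) r) ->
  exists s : {linear M -> res_mod F 0}, forall m, res_aug F (s m) = r *: m.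
Proof.
move=> nR /fg_family[n [x xM]] annr.
have xL : linear (fun c : 'rV[R]_n => \sum_i c 0 i *: x i).
  move=> a b c; rewrite scaler_sumr -big_split /=.
  by apply: eq_bigr => i _; rewrite !mxE scalerDl scalerA.
have [m [A AE]] := noetherian_row nR (ker_pred (mk_linear xL)).
have /choice[y yE] : forall i, exists y, res_aug F y = x i.
  by move=> i; exact: res_aug_surj.
have /choice[g gE] : forall j, exists g, res_diff F 0 g = \sum_i A j i *: y i.
  move=> j; apply/res_exact0; rewrite linear_sum /=.
  have /ker_predP/= : row j A \in ker_pred (mk_linear xL).
    by apply/(AE _); exists (delta_mx 0 j); rewrite -rowE.
  by move=> Ax; rewrite -[RHS]Ax; apply: eq_bigr => i _; rewrite linearZ /= yE mxE.
have /ann_homologyP annA := annr _ (transpose_fg A).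
have [|w wE] := annA (\sum_j tens (g j) (transpose_gen A j)).
  rewrite linear_sum /=; under eq_bigr do rewrite tensor_mapE gE tens_suml.
  rewrite exchange_big big1 //= => i _.
  by rewrite -tens_sumr transpose_rel tens0r.
have [|||h hS hE] := @transpose_tensor_boundary _ _ (res_diff F 0)
    (ker_pred (res_aug F)) r m n A g _ (res_diff F 1) w.
- by move=> k; apply/ker_predP; exact: res_augd.
- exact: res_dd.
- by rewrite wE scaler_sumr; apply: eq_bigr => j _; rewrite tensZl.
have tL : linear (fun c : 'rV[R]_n => \sum_i c 0 i *: (r *: y i - h i)).
  move=> a b c; rewrite scaler_sumr -big_split /=.
  by apply: eq_bigr => i _; rewrite !mxE scalerDl scalerA.
have [||s sE] := @surj_factor _ _ _ _ (mk_linear xL) (mk_linear tL).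
- by move=> v; have /xM[c ->] : v \in predT by []; exists c.
- move=> c /ker_predP/AE[b ->]; rewrite mulmx_sum_row linear_sum big1 // => j _.
  rewrite linearZ /=.
  under eq_bigr do rewrite mxE scalerBr.
  rewrite sumrB -hE gE scaler_sumr.
  under eq_bigr do rewrite scalerA mulrC -scalerA.
  by rewrite subrr scaler0.
exists s => v; have /xM[c ->] : v \in predT by [].
rewrite [s _](sE c) /= linear_sum scaler_sumr /=; apply: eq_bigr => i _.
rewrite linearZ linearB /= linearZ /= yE.
by rewrite (elimT (ker_predP _ _) (hS i)) subr0 !scalerA mulrC.
Qed.

End Transpose.

(** * Fractional modules *)

Section FractionalModules.
Variable R : comPzRingType.

Lemma total_frac_nzd_inj (s : R) (p q : total_frac R) :
  s \in non_zero_divisor -> s *: p = s *: q -> p = q.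
Proof.
move=> sP spq; apply/eqP; rewrite -subr_eq0; apply/eqP.
move: spq => /eqP; rewrite -subr_eq0 -scalerBr => /eqP.
elim/frac_ind: (p - q) => a t tP.
rewrite -[_ *: _]/(frac_scale s (Defs.frac a tP)) frac_scaleE => /fracP.
rewrite mulr1 mul0r => sa; apply/fracP; rewrite mulr1 mul0r.
by move: sP => /asboolP; apply.
Qed.

Lemma total_frac_denom (q : total_frac R) :
  exists s a : R, s \in non_zero_divisor /\ s *: q = to_frac a.
Proof.
elim/frac_ind: q => a s sP; exists s, a; split=> //.
by rewrite total_frac_scaleE mulrC frac_mul_denom.
Qed.

Variable M : submodClosed (total_frac R).

(** Clear denominators: if [s x = a] and [t y = b] with [a], [b] in [R], then
    [(t a) y = (s b) x], an equation in [M] even when [M] does not contain 1.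
    Applying [f] gives [t a f(y) = s b f(x)] in [R], which is the claim
    multiplied by the non-zero-divisor [s t]. *)
Lemma functional_exchange (f : {linear submod M -> R^o}) (x y : submod M) :
  (f x : R) *: y = (f y : R) *: x.
Proof.
have [s [a [sP sx]]] := total_frac_denom (val x).
have [t [b [tP ty]]] := total_frac_denom (val y).
have E : (t * a) *: y = (s * b) *: x.
  apply: val_inj; rewrite /= mulrC -scalerA ty mulrC -scalerA sx !total_frac_scaleE.
  by rewrite mulrC.
have fE : t * a * (f y : R) = s * b * (f x : R).
  by have := congr1 f E; rewrite !linearZ.
apply: val_inj; apply: (total_frac_nzd_inj (nzdM sP tP)) => /=.
rewrite !scalerA; rewrite (_ : s * t * f x = s * f x * t); last by rewrite mulrAC.
rewrite (_ : s * t * f y = t * f y * s); last by rewrite mulrC mulrA mulrAC [f y * t]mulrC.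
rewrite -!scalerA ty sx !total_frac_scaleE -!rmorphM; congr to_frac.
by rewrite [LHS]mulrCA [LHS]mulrC -fE -mulrA [a * _]mulrC.
Qed.

(** Each [f k : M -> R] is followed by the map [R -> P] that sends 1 to a
    lift of [x k]; the exchange rule turns [\sum_k f k m *: x k] into [r *: m]. *)
Lemma trace_factor (P : lmodType R) (p : {linear P -> submod M}) r :
  (forall x, exists y, p y = x) -> trace_ideal (submod M) r ->
  exists s : {linear submod M -> P}, forall m, p (s m) = r *: m.
Proof.
move=> p_surj [n [f [x ->]]].
have /choice[y yE] : forall k, exists y, p y = x k by move=> k; exact: p_surj.
have sL : linear (fun m => \sum_k (f k m : R) *: y k).
  move=> a u v; rewrite scaler_sumr -big_split /=.
  by apply: eq_bigr => k _; rewrite linearP scalerDl scalerA.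
exists (mk_linear sL) => m /=; rewrite linear_sum scaler_suml.
by apply: eq_bigr => k _; rewrite linearZ /= yE functional_exchange.
Qed.

(** Splitting the free cover of [P] replaces [P] by a free module, whose
    coordinates give linear forms on [M]; only finitely many of them are
    non-zero at the non-zero-divisor [a]. *)
Lemma factor_trace (P : lmodType R) (p : {linear P -> submod M})
    (s : {linear submod M -> P}) r :
  projective P -> (exists2 a : R, a \in non_zero_divisor & to_frac a \in M) ->
  (forall m, p (s m) = r *: m) -> trace_ideal (submod M) r.
Proof.
move=> projP [a aP aM] sE.
have [h hE] := projP _ _ (free_cover P) idfun (@free_cover_surj _ P).
have coefL x : linear (fun m => coef (h (s m)) x : R^o).
  by move=> c u v; rewrite !linearP coef_linear.
pose f x := mk_linear (coefL x).
pose S : submod M := Submod aM.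
pose X := free_supp (h (s S)).
have rS : r *: S = (\sum_(x <- X) (f x (p x) : R)) *: S.
  rewrite -sE -[s S](hE (s S)) [free_cover P _]/(free_lift _ _) /free_lift.
  rewrite linear_sum scaler_suml; apply: eq_bigr => x _.
  by rewrite linearZ; exact: (functional_exchange (f x) S (p x)).
exists (size X), (fun k => f (tnth (in_tuple X) k)),
  (fun k => p (tnth (in_tuple X) k)).
rewrite -(big_tnth _ _ X xpredT (fun x => f x (p x))).
apply: (nzd_cancel aP); apply: to_frac_inj.
have /(congr1 val) := rS; rewrite /= !total_frac_scaleE -!rmorphM.
by rewrite mulrC [in RHS]mulrC.
Qed.

End FractionalModules.

(** * The theorem *)

Theorem theorem1p1 (R : comPzRingType) (M : submodClosed (total_frac R))
    (F : projective_resolution (submod M)) :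
  noetherian_ring R ->
  finitely_generated M ->
  (exists2 s : R, s \in non_zero_divisor & to_frac s \in M) ->
  [/\ trace_ideal (submod M) =
        [set r | forall (i : nat) (N : lmodType R),
                   (0 < i)%N -> fg_module N -> ann (Tor i (submod M) N) r],
      trace_ideal (submod M) =
        [set r | forall (i : nat) (N : lmodType R),
                   (0 < i)%N -> ann (Ext i (submod M) N) r] &
      trace_ideal (submod M) = ann (Ext 1 (submod M) (syzygy1 F))].
Proof.
move=> nR fgM nzdM.
pose G := std_resolution (submod M).
have trP r : trace_ideal (submod M) r -> forall n,
    exists (h : {linear res_mod G n -> res_mod G n.+1})
           (h' : {linear res_mod G n.+1 -> res_mod G n.+2}),
      forall x, res_diff G n.+1 (h' x) + h (res_diff G n x) = r *: x.
  move=> /(trace_factor (@res_aug_surj _ _ G))[s sE].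
  exact: factor_nullhomotopic sE.
have tr_Ext r : trace_ideal (submod M) r -> forall i N, (0 < i)%N ->
    ann (Ext i (submod M) N) r.
  move=> /trP hr [//|i] N _; have [h [h' hE]] := hr i.
  exact: nullhomotopic_ann_Ext hE.
have Ext_tr r : ann (Ext 1 (submod M) (syzygy1 F)) r -> trace_ideal (submod M) r.
  move=> /ann_Ext_factor[s sE].
  exact: factor_trace (@res_projective _ _ F 0) nzdM sE.
split; apply/seteqP; split=> r.
- move=> /trP hr [//|i] N _ _; have [h [h' hE]] := hr i.
  exact: nullhomotopic_ann_Tor hE.
- move=> hr; have [N fgN|s sE] := @ann_Tor_factor _ _ G r nR (fg_submod fgM).
    exact: (hr 1%N).
  exact: factor_trace (@res_projective _ _ G 0) nzdM sE.
- exact: tr_Ext.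
- by move=> hr; apply: Ext_tr; exact: hr.
- by move=> hr; exact: tr_Ext.
- exact: Ext_tr.
Qed.
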